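(* The static decision version of the bandit tree search problem (BTS) reduces to the static decision version of the tokenized multi-armed bandit problem (TMAB) with monotone utility function: every instance of static decision BTS can be transformed into an instance of static decision TMAB whose utility function is monotone, such that the BTS instance is a Yes instance if and only if the TMAB instance is a Yes instance.
   Context: **Static decision BTS.** An instance consists of a rooted binary tree of depth $d$, a utility function $v$ assigning a nonnegative real value $v(l)$ to every leaf $l$, and a threshold $A\ge0$. It is a Yes instance iff there is a leaf $l$ with $v(l)\ge A$. **Static decision TMAB.** An instance consists of a finite token set $\mathcal V$ containing a special token $\mathrm{EOS}$, a maximal length $L$, a utility function $u$ from finite token sequences over $\mathcal V$ to $\mathbb R_{\ge0}$, and a threshold $A\ge0$. A sequence is complete if its last token is $\mathrm{EOS}$. It is a Yes instance iff there is a complete sequence $\mathbf y$ of length at most $L$ with $u(\mathbf y)\ge A$. **Monotone.** $u$ is monotone if (i) appending further $\mathrm{EOS}$ tokens to a sequence ending in $\mathrm{EOS}$ does not change $u$, and (ii) appending a non-$\mathrm{EOS}$ token to a sequence ending in $\mathrm{EOS}$ can only decrease $u$. *)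

(* Defs.v *)
From HB Require Import structures.
From mathcomp Require Import all_boot all_order all_algebra.
From mathcomp Require Import interval_inference reals.

Set Implicit Arguments.
Unset Strict Implicit.
Unset Printing Implicit Defensive.

Import Order.TTheory GRing.Theory Num.Theory.
Local Open Scope ring_scope.

(** Every node has at most two children; the leaves need not all have the same
    depth. *)
Inductive bintree : Type :=
| Leaf
| Node1 (t : bintree)
| Node2 (t1 t2 : bintree).

Fixpoint tree_depth (t : bintree) : nat :=
  match t with
  | Leaf => 0
  | Node1 t1 => (tree_depth t1).+1
  | Node2 t1 t2 => (maxn (tree_depth t1) (tree_depth t2)).+1
  end.

(** A leaf is identified by the branches taken from the root: [false] for the
    only or left child, [true] for the right child. *)
Fixpoint leaf_paths (t : bintree) : seq (seq bool) :=
  match t with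
  | Leaf => [:: [::]]
  | Node1 t1 => map (cons false) (leaf_paths t1)
  | Node2 t1 t2 =>
      map (cons false) (leaf_paths t1) ++ map (cons true) (leaf_paths t2)
  end.

Definition leaf (t : bintree) : finType := seq_sub (leaf_paths t).

(** Instances are split into their parameters and their utility function, so
    that a reduction can be required to access the utility only by queries. *)
Record bts_params (R : realType) := BTSParams {
  bts_tree : bintree;
  bts_threshold : {nonneg R}
}.

Definition bts_utility (R : realType) (P : bts_params R) : Type :=
  leaf (bts_tree P) -> {nonneg R}.

Record bts_instance (R : realType) := BTSInstance {
  bts_par : bts_params R;
  bts_util : bts_utility bts_par
}.

Definition bts_depth (R : realType) (B : bts_instance R) : nat :=
  tree_depth (bts_tree (bts_par B)).

Definition bts_yes (R : realType) (B : bts_instance R) : Prop :=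
  exists l : leaf (bts_tree (bts_par B)),
    (bts_threshold (bts_par B))%:num <= (bts_util l)%:num.

Record tmab_params (R : realType) := TMABParams {
  tmab_token : finType;
  tmab_eos : tmab_token;
  tmab_maxlen : nat;
  tmab_threshold : {nonneg R}
}.

Definition tmab_utility (R : realType) (Q : tmab_params R) : Type :=
  seq (tmab_token Q) -> {nonneg R}.

Record tmab_instance (R : realType) := TMABInstance {
  tmab_par : tmab_params R;
  tmab_util : tmab_utility tmab_par
}.

(** The empty sequence has no last token, hence is not complete. *)
Definition complete (V : eqType) (eos : V) (y : seq V) : bool :=
  if y is x :: s then last x s == eos else false.

Definition tmab_yes (R : realType) (T : tmab_instance R) : Prop :=
  exists y : seq (tmab_token (tmab_par T)),
    [/\ complete (tmab_eos (tmab_par T)) y,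
        (size y <= tmab_maxlen (tmab_par T))%N
      & (tmab_threshold (tmab_par T))%:num <= (tmab_util y)%:num].

Definition monotone (R : realType) (V : eqType) (eos : V)
    (u : seq V -> {nonneg R}) : Prop :=
  (forall (y : seq V) (k : nat),
     complete eos y -> u (y ++ nseq k eos) = u y) /\
  (forall (y : seq V) (x : V),
     complete eos y -> x != eos -> (u (rcons y x))%:num <= (u y)%:num).

Definition tmab_monotone (R : realType) (T : tmab_instance R) : Prop :=
  monotone (tmab_eos (tmab_par T)) (@tmab_util R T).

(** The parameters of the image do not depend on the utility function. *)
Record transformation (R : realType) := Transformation {
  tr_params : bts_params R -> tmab_params R;
  tr_util : forall P : bts_params R,
    bts_utility P -> tmab_utility (tr_params P)
}.

Definition transform (R : realType) (f : transformation R)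
    (B : bts_instance R) : tmab_instance R :=
  TMABInstance (@tr_util R f (bts_par B) (@bts_util R B)).

(** Any decidable problem reduces to TMAB by an unrestricted map that first
    solves the instance.  [one_query] and [poly_size] exclude this: utilities
    are black boxes, and evaluating the new utility at a sequence uses the value
    of the old one at a single leaf, chosen independently of the utility. *)
Definition one_query (R : realType) (f : transformation R) : Prop :=
  forall (P : bts_params R) (y : seq (tmab_token (tr_params f P))),
    exists l : leaf (bts_tree P),
      forall v w : bts_utility P, v l = w l -> @tr_util R f P v y = @tr_util R f P w y.

Definition poly_size (R : realType) (f : transformation R) : Prop :=
  exists c k : nat, forall B : bts_instance R,
    (#|tmab_token (tmab_par (transform f B))|
       + tmab_maxlen (tmab_par (transform f B))
     <= c * (bts_depth B).+1 ^ k)%N.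

(* Main.v *)
(** The tokens are the two branches and EOS. A token sequence is read as
    directions for a walk from the root: the walk follows the tokens before the
    first EOS and continues to the left when they are exhausted, so that it
    always ends at a leaf, whose value is the utility of the sequence. Tokens
    after an EOS are never read, hence both monotonicity conditions hold with
    equality, and every leaf is reached by its own path followed by EOS. *)
Require Import Defs.
From HB Require Import structures.
From mathcomp Require Import all_boot all_order all_algebra.
From mathcomp Require Import interval_inference reals.

Fixpoint directions (y : seq (option bool)) : seq bool :=
  if y is Some b :: y' then b :: directions y' else [::].

(** Reading stops at the first [None], which already lies inside [y]. *)
Lemma directions_cat (y z : seq (option bool)) :
  None \in y -> directions (y ++ z) = directions y.
Proof. by elim: y => [|[b|] y IHy] //=; rewrite inE /= => /IHy ->. Qed.

Lemma directions_rcons_None (s : seq bool) :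
  directions (rcons (map Some s) None) = s.
Proof. by elim: s => //= b s ->. Qed.

(** The result is [s] corrected to a genuine leaf path: a one-child node consumes a direction but
    always records [false], and entries left over at a leaf are dropped. *)
Fixpoint walk (t : bintree) (s : seq bool) : seq bool :=
  match t with
  | Leaf => [::]
  | Node1 t1 => false :: walk t1 (behead s)
  | Node2 t1 t2 =>
      if head false s then true :: walk t2 (behead s)
      else false :: walk t1 (behead s)
  end.

Lemma walk_leaf (t : bintree) (s : seq bool) : walk t s \in leaf_paths t.
Proof.
elim: t s => [|t1 IH1|t1 IH1 t2 IH2] s //=; first exact: map_f.
by rewrite mem_cat; case: head; rewrite map_f ?orbT.
Qed.

Lemma walk_id (t : bintree) (s : seq bool) : s \in leaf_paths t -> walk t s = s.
Proof.
elim: t s => [|t1 IH1|t1 IH1 t2 IH2] s /=; first by rewrite inE => /eqP.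
  by case/mapP=> p /IH1 + -> /= => ->.
by rewrite mem_cat => /orP[] /mapP[p + ->] /= => [/IH1|/IH2] ->.
Qed.

Lemma size_leaf_paths (t : bintree) (s : seq bool) :
  s \in leaf_paths t -> size s <= tree_depth t.
Proof.
elim: t s => [|t1 IH1|t1 IH1 t2 IH2] s /=; first by rewrite inE => /eqP ->.
  by case/mapP=> p /IH1 + ->.
by rewrite mem_cat => /orP[] /mapP[p + ->] /= => [/IH1|/IH2] le_p;
  rewrite ltnS leq_max le_p ?orbT.
Qed.

Lemma complete_mem (V : eqType) (eos : V) (y : seq V) :
  complete eos y -> eos \in y.
Proof. by case: y => //= x s /eqP <-; exact: mem_last. Qed.

Lemma complete_rcons (V : eqType) (eos : V) (y : seq V) :
  complete eos (rcons y eos).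
Proof. by case: y => [|x y] /=; rewrite ?last_rcons. Qed.

Definition walk_end (t : bintree) (y : seq (option bool)) : leaf t :=
  SeqSub (walk_leaf t (directions y)).

Lemma walk_end_cat (t : bintree) (y z : seq (option bool)) :
  complete None y -> walk_end t (y ++ z) = walk_end t y.
Proof.
by move=> /complete_mem y_eos; apply: val_inj; rewrite /= directions_cat.
Qed.

Lemma walk_end_path (t : bintree) (l : leaf t) :
  walk_end t (rcons (map Some (val l)) None) = l.
Proof.
by apply: val_inj; rewrite /= directions_rcons_None walk_id //; exact: valP.
Qed.

(** [None] serves as EOS; the extra 1 in the length makes room for it after a longest leaf path. *)
Definition walk_params (R : realType) (P : bts_params R) : tmab_params R :=
  @TMABParams R (option bool) None (tree_depth (bts_tree P)).+1 (bts_threshold P).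

Definition walk_transformation (R : realType) : transformation R :=
  @Transformation R (@walk_params R)
    (fun P v y => v (walk_end (bts_tree P) y)).

Theorem theoremC1 (R : realType) :
  exists f : transformation R,
    [/\ one_query f,
        poly_size f
      & forall B : bts_instance R,
          tmab_monotone (transform f B) /\
          (bts_yes B <-> tmab_yes (transform f B))].
Proof.
exists (walk_transformation R); split.
- by move=> P y; exists (walk_end (bts_tree P) y).
(* With depth d, three tokens and length d + 1 give d + 4, at most 4(d + 1). *)
- exists 4, 1 => B; rewrite /= card_option card_bool expn1 /bts_depth.
  by rewrite addnS -addSn mulnS leq_add2l leq_pmull.
move=> [P v]; split; first split=> [y k|y x] y_eos /=.
- by rewrite walk_end_cat.
- by rewrite -cats1 walk_end_cat.
(* The utility of [y] is by definition the value of the leaf where its walk ends, so that leaf is a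
   witness. *)
split=> [[l le_l]|[y [_ _ le_y]]]; last by exists (walk_end (bts_tree P) y).
exists (rcons (map Some (val l)) None); split.
- exact: complete_rcons.
- rewrite size_rcons size_map ltnS; apply: size_leaf_paths; exact: valP.
- by rewrite /= walk_end_path.
Qed.
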